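(* Let $n\in\mathbb{N}$, let $K\subseteq\mathbb{R}^n$ be closed, and let $T=\sum_{\alpha\in\mathbb{N}_0^n} q_\alpha\,\partial^\alpha:\mathbb{R}[x_1,\dots,x_n]\to\mathbb{R}[x_1,\dots,x_n]$ be a linear operator with $q_\alpha\in\mathbb{R}[x_1,\dots,x_n]$. Let $S:\mathbb{R}^{\mathbb{N}_0^n}\to\mathbb{R}^{\mathbb{N}_0^n}$ be the dual operator of $T$, i.e. the linear map determined by $L_{Ss}(p)=L_s(Tp)$ for all $s\in\mathbb{R}^{\mathbb{N}_0^n}$ and $p\in\mathbb{R}[x_1,\dots,x_n]$. Then the following are equivalent: (i) $S$ maps $K$-moment sequences to $K$-moment sequences; (ii) for every $y\in K$, the sequence $(\alpha!\cdot q_\alpha(y))_{\alpha\in\mathbb{N}_0^n}$ is a $(K-y)$-moment sequence, where $K-y=\{k-y: k\in K\}$.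
   Context: Every linear map $T:\mathbb{R}[x_1,\dots,x_n]\to\mathbb{R}[x_1,\dots,x_n]$ can be written uniquely as $T=\sum_{\alpha}q_\alpha\partial^\alpha$ with polynomial coefficients $q_\alpha$. For a real sequence $s=(s_\alpha)_{\alpha\in\mathbb{N}_0^n}$, the Riesz functional $L_s:\mathbb{R}[x_1,\dots,x_n]\to\mathbb{R}$ is the linear map with $L_s(x^\alpha)=s_\alpha$. For a closed set $K\subseteq\mathbb{R}^n$, $s$ is a $K$-moment sequence if there is a (positive) Borel measure $\mu$ on $\mathbb{R}^n$ supported in $K$ with $\int|x^\alpha|\,d\mu<\infty$ and $s_\alpha=\int x^\alpha\,d\mu(x)$ for all $\alpha\in\mathbb{N}_0^n$. Multi-index notation: $\alpha!=\alpha_1!\cdots\alpha_n!$, $x^\alpha=x_1^{\alpha_1}\cdots x_n^{\alpha_n}$, $\partial^\alpha=\partial_1^{\alpha_1}\cdots\partial_n^{\alpha_n}$. *)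

(* Defs.v *)
From HB Require Import structures.
From mathcomp Require Import all_boot all_order all_algebra.
From mathcomp Require Import mpoly.
From mathcomp Require Import all_classical all_reals all_analysis.
Import numFieldTopology.Exports numFieldNormedType.Exports.

Set Implicit Arguments.
Unset Strict Implicit.
Unset Printing Implicit Defensive.

Import Order.TTheory GRing.Theory Num.Theory.
Local Open Scope classical_set_scope.
Local Open Scope ring_scope.

Definition mexp (n : nat) (a : mpoly.multinom n) (i : 'I_n) : nat :=
  tnth (mpoly.multinom_val a) i.

Definition mfact (n : nat) (a : mpoly.multinom n) : nat :=
  (\prod_(i < n) (mexp a i)`!)%N.

Definition mono (R : realType) (n : nat) (a : mpoly.multinom n)
  (x : 'rV[R]_n) : R :=
  \prod_(i < n) (x ord0 i) ^+ (mexp a i).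

Definition peval (R : realType) (n : nat) (q : mpoly.mpoly n R)
  (y : 'rV[R]_n) : R :=
  mpoly.meval (fun i => y ord0 i) q.

Definition mnm_of (n d : nat) (f : {ffun 'I_n -> 'I_d}) : mpoly.multinom n :=
  mpoly.Multinom [tuple (nat_of_ord (f i)) | i < n].

Definition degbound (R : realType) (n : nat) (p : mpoly.mpoly n R) : nat :=
  (\max_(m <- mpoly.msupp p) mpoly.mdeg m).+1.

(* T p = sum_alpha q_alpha * d^alpha p.  The sum is finite: d^alpha p = 0
   unless alpha <= m componentwise for some monomial m of p, in particular
   unless every alpha_i < degbound p; we sum over all those alpha
   (each such alpha is hit by exactly one f). *)
Definition diffop (R : realType) (n : nat)
  (q : mpoly.multinom n -> mpoly.mpoly n R) (p : mpoly.mpoly n R)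
  : mpoly.mpoly n R :=
  \sum_(f : {ffun 'I_n -> 'I_(degbound p)})
     q (mnm_of f) * mpoly.mderivm (mnm_of f) p.

Definition riesz (R : realType) (n : nat) (s : mpoly.multinom n -> R)
  (p : mpoly.mpoly n R) : R :=
  \sum_(m <- mpoly.msupp p) mpoly.mcoeff m p * s m.

Definition borelRn (R : realType) (n : nat) :=
  g_sigma_algebraType (open : set (set 'rV[R]_n)).

Definition is_moment_seq (R : realType) (n : nat) (K : set 'rV[R]_n)
  (s : mpoly.multinom n -> R) : Prop :=
  exists mu : {measure set (borelRn R n) -> \bar R},
    mu (~` K) = 0%E /\
    forall a : mpoly.multinom n,
      mu.-integrable [set: borelRn R n] (fun x => (mono a x)%:E) /\
      (s a)%:E = (\int[mu]_x (mono a x)%:E)%E.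

(* Main.v *)
Require Import Defs.
From HB Require Import structures.
From mathcomp Require Import all_boot all_order all_algebra.
From mathcomp Require Import mpoly.
From mathcomp Require Import all_classical all_reals all_analysis.
From mathcomp Require Import measurable_realfun.
From mathcomp Require Import zify ring lra.
Import numFieldTopology.Exports numFieldNormedType.Exports.
Import Order.TTheory GRing.Theory Num.Theory.
Local Open Scope classical_set_scope.
Local Open Scope ring_scope.

(** Writing c_y := (a! q_a(y))_a, Taylor's formula gives (T p)(y) = L_{c_y}(p(. + y)).  If s is the
    moment sequence of the point mass at y in K, then S s is a K-moment sequence, and translating
    its measure by - y represents c_y.  Conversely, if c_y is a (K - y)-moment sequence for every
    y in K, then T maps polynomials nonnegative on K to polynomials nonnegative on K, so L_{S s}
    is nonnegative on polynomials nonnegative on K and Haviland's theorem applies.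

    For Haviland's theorem, extend the positive functional, by Zorn's lemma, to all functions (not
    only the continuous ones) dominated on K by a polynomial.  Its values on indicators are a
    finitely additive content m on all sets, and the outer measure of countable open covers built
    from m is a Borel measure mu with m(C) <= mu(C) for C compact and mu(U) <= m(U) for U open.
    Comparing a continuous f >= 0 with sums of indicators of its superlevel sets turns these two
    inequalities into the integral representation, the tails being controlled by f^2 and by
    f * |x|^2. *)

Set Implicit Arguments.
Unset Strict Implicit.
Unset Printing Implicit Defensive.

(** * From finitely additive contents to Borel measures *)

Section ContentToMeasure.
Context {R : realType} {T : normedModType R}.
Variable m : set T -> R.
Hypothesis m_ge0 : forall A, 0 <= m A.
Hypothesis mU : forall A B, A `&` B = set0 -> m (A `|` B) = m A + m B.

Local Notation borel := (g_sigma_algebraType (open : set (set T))).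

Lemma content0 : m set0 = 0.
Proof. by have := mU (setI0 set0); rewrite setU0 -[LHS]addr0 => /addrI. Qed.

Lemma content_mono A B : A `<=` B -> m A <= m B.
Proof.
by move=> AB; rewrite -(setDUK AB) mU ?setDIK// lerDl.
Qed.

Lemma content_disjoint_le A B C :
  A `&` B = set0 -> A `<=` C -> B `<=` C -> m A + m B <= m C.
Proof. by move=> AB AC BC; rewrite -mU//; apply: content_mono; rewrite subUset. Qed.

Lemma content_bigsetU_le (F : nat -> set T) N :
  m (\big[setU/set0]_(i < N) F i) <= \sum_(i < N) m (F i).
Proof.
elim: N => [|N IH]; first by rewrite !big_ord0 content0.
rewrite !big_ord_recr /=; set B := \big[_/_]_(i < N) F i in IH *.
rewrite -(setDUK (@subsetUl _ B (F N))) mU ?setDIK// lerD//.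
by apply: content_mono => x [[]].
Qed.

(* The value +oo off the open sets turns [mu_ext] into the outer measure of countable open
   covers. *)
Definition open_cost (A : set borel) : \bar R :=
  if `[< open (A : set T) >] then (m A)%:E else +oo%E.

Lemma open_costE (A : set T) : open A -> open_cost A = (m A)%:E.
Proof. by rewrite /open_cost; case: asboolP. Qed.

Lemma open_cost_ge0 (A : set borel) : (0 <= open_cost A)%E.
Proof. by rewrite /open_cost; case: ifP; rewrite ?lee_fin. Qed.

Lemma open_cost0 : open_cost set0 = 0%E.
Proof. by rewrite open_costE ?content0//; exact: open0. Qed.

Definition content_outer : set borel -> \bar R := mu_ext open_cost.

HB.instance Definition _ := isOuterMeasure.Build R borel content_outer
  (mu_ext0 open_cost0 open_cost_ge0) (mu_ext_ge0 open_cost_ge0)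
  (le_mu_ext open_cost) (mu_ext_sigma_subadditive open_cost_ge0).

Lemma content_outer_open_le (U : set T) : open U -> (content_outer U <= (m U)%:E)%E.
Proof.
move=> oU; apply: ereal_inf_lbound => /=.
exists (fun k => if k is 0%N then (U : set borel) else set0).
  split; first by case=> [|i]; [exact: sub_sigma_algebra|exact: measurable0].
  by move=> x Ux; exists 0%N.
rewrite nneseries_recl//; last by move=> *; exact: open_cost_ge0.
rewrite open_costE// eseries_cond/= eseries0 ?adde0// => -[|]//= k _ _.
by rewrite open_cost0.
Qed.

(** A cover of finite cost consists of open sets, so compactness leaves a finite subcover, for which
    finite subadditivity of [m] is enough. *)
Lemma content_le_outer_compact (C : set T) : compact C -> ((m C)%:E <= content_outer C)%E.
Proof.
move=> cC; apply: le_ereal_inf_tmp => _ [F [mF CF] <-].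
have [oF|/existsNP[i Fi]] := pselect (forall i, open (F i : set T)); last first.
  rewrite (@eseries_pinfty _ _ xpredT i) ?leey//; last first.
    by rewrite /open_cost asboolF.
  by move=> j _; rewrite -ltNye (lt_le_trans _ (open_cost_ge0 _)).
move: cC; rewrite compact_cover => /(_ nat setT (F : nat -> set T)).
case=> [i _ //|//|D _ CD].
pose N := (\max_(i <- finmap.enum_fset D) i).+1.
apply: (@le_trans _ _ (\sum_(0 <= i < N) open_cost (F i))%E); last first.
  by apply: nneseries_lim_ge => k *; exact: open_cost_ge0.
rewrite (eq_bigr (fun i => (m (F i))%:E)); last by move=> i _; exact: open_costE.
rewrite sumEFin lee_fin big_mkord.
apply: le_trans (content_bigsetU_le F N).
apply: content_mono => x /CD[i Di Fx]; rewrite -bigcup_mkord; exists i => //=.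
by rewrite /N ltnS; apply: leq_bigmax_seq.
Qed.

(** The argument for metric outer measures: [V] meets [U] in a union of open sets [W k] lying at
    positive distance from the complement of [U], and each of them is disjoint from an open set
    around the rest of [V]. *)
Lemma content_outer_open_split (U V : set T) : open U -> open V ->
  (content_outer (V `&` U) + content_outer (V `&` ~` U) <= (m V)%:E)%E.
Proof.
move=> oU oV.
pose d := edist_inf (~` U) : T -> \bar R.
have dc : continuous d by exact: edist_inf_continuous.
have gto r : open [set x | (r < d x)%E].
  by move/continuousP: dc => /(_ [set y | (r < y)%E]); apply; exact: open_ereal_gt_ereal.
have lto r : open [set x | (d x < r)%E].
  by move/continuousP: dc => /(_ [set y | (y < r)%E]); apply; exact: open_ereal_lt_ereal.
(* The contents of the shells S j are summable because S j and W j are disjoint subsets of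
   W j.+2; hence the W k exhaust V `&` U in outer measure. *)
pose W (k : nat) := V `&` [set x | ((k.+1%:R^-1 : R)%:E < d x)%E].
pose S (k : nat) := V `&` [set x | ((k.+3%:R^-1 : R)%:E < d x)%E]
                      `&` [set x | (d x < (k.+1%:R^-1 : R)%:E)%E].
have oW k : open (W k) by apply: openI.
have oS k : open (S k) by apply: openI => //; apply: openI.
have Wmono k l : (k <= l)%N -> W k `<=` W l.
  move=> kl x [Vx /= dx]; split=> //=; apply: le_lt_trans dx.
  by rewrite lee_fin lef_pV2 ?posrE ?ltr0n// ler_nat ltnS.
have mWS j : m (W j) + m (S j) <= m (W j.+2).
  apply: content_disjoint_le; [|exact: Wmono (leqW (leqnSn j))|].
    apply/seteqP; split=> // x [[_ /= h1] [_ /= h2]].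
    by move: (lt_trans h1 h2); rewrite ltxx.
  by move=> x [[Vx h] _].
have WV k : ((m (W k))%:E + content_outer (V `&` ~` U) <= (m V)%:E)%E.
  (* [d] vanishes off [U], so [Z] is open, contains [V] minus [U], and avoids [W k]. *)
  pose Z := V `&` [set x | (d x < (k.+1%:R^-1 : R)%:E)%E].
  have : (content_outer (V `&` ~` U) <= (m Z)%:E)%E.
    apply: le_trans (content_outer_open_le (openI oV (lto _))).
    apply: le_outer_measure => x [Vx Ux]; split=> //=.
    by rewrite /d edist_inf0// lte_fin invr_gt0 ltr0n.
  move=> /(leeD2l (m (W k))%:E) /le_trans; apply; rewrite -EFinD lee_fin.
  apply: content_disjoint_le; [|by move=> x []|by move=> x []].
  apply/seteqP; split=> // x [[_ /= h1] [_ /= h2]].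
  by move: (lt_trans h1 h2); rewrite ltxx.
(* [mWS] moves the index by two, so the telescoping keeps two boundary terms at each end. *)
have Wtel k N : \sum_(j < N) m (S (k + j)%N) + (m (W k) + m (W k.+1)) <=
    m (W (k + N)%N) + m (W (k + N).+1).
  elim: N => [|N IH]; first by rewrite big_ord0 add0r addn0.
  rewrite big_ord_recr /= addnS; have := mWS (k + N)%N; lra.
pose s := sup [set m (W k) | k in [set: nat]].
have hs : has_sup [set m (W k) | k in [set: nat]].
  split; first by exists (m (W 0%N)), 0%N.
  by exists (m V) => _ [k _ <-]; apply: content_mono => x [].
have Ws k : m (W k) <= s by apply: ub_le_sup; [exact: hs.2|exists k].
apply/lee_addgt0Pr => e e0.
have e30 : 0 < e / 3 by lra.
have [_ [k _ <-] ske] := sup_adherent e30 hs.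
rewrite -/s in ske.
have aVU : (content_outer (V `&` U) <= (s + 2 * (e / 3))%:E)%E.
  (* Starting from [W k.+1] rather than [W k] catches the points where [d x] equals 1/(k+1), which
     the strict inequalities exclude from both [W k] and [S k]. *)
  pose G i := if i is j.+1 then S (k + j)%N else W k.+1.
  have VUG : V `&` U `<=` \bigcup_i G i.
    move=> x [Vx Ux].
    have [r r0 rd] : exists2 r : R, 0 < r & (r%:E <= d x)%E.
      have /nbhs_ballP[r /= r0 xrU] : nbhs x U by exact: open_nbhs_nbhs.
      exists r => //; apply: le_ereal_inf_tmp => _ [a /= Ua <-].
      by rewrite leNgt; apply/negP => /edist_lt_ball/xrU.
    have kd : exists k0, ((k0.+1%:R^-1 : R)%:E < d x)%E.
      have [k0 _ /(_ k0 (leqnn _)) k0r] := near_infty_natSinv_lt (PosNum r0).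
      by exists k0; apply: lt_le_trans rd; rewrite lte_fin.
    (* With [l] minimal, 1/(l+1) < [d x] <= 1/l, which puts [x] in the shell [S l.-2] as soon as [l]
       exceeds [k.+1]. *)
    case: (ex_minnP kd) => l ld lmin.
    have [lk|kl] := leqP l k.+1.
      by exists 0%N => //; apply: (Wmono l) => //; split.
    exists (l - k.+1)%N => //.
    have -> : (l - k.+1 = (l - k.+2).+1)%N by rewrite -subSn// subSS.
    rewrite /G; have -> : (k + (l - k.+2) = l.-2)%N by lia.
    have -> : l = l.-2.+2 by lia.
    split; first by split=> //=; have -> : l.-2.+3 = l.+1 by lia.
    rewrite /= ltNge; apply/negP => dl.
    have : ((l.-2.+2%:R^-1 : R)%:E < d x)%E.
      apply: lt_le_trans dl; rewrite lte_fin ltf_pV2 ?posrE ?ltr0n// ltr_nat.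
      by lia.
    by move=> /lmin; lia.
  apply: (le_trans (le_outer_measure _ _ _ VUG)).
  apply: (le_trans (outer_measure_sigma_subadditive _ G)).
  apply: lime_le; first by apply: is_cvg_nneseries => *; exact: outer_measure_ge0.
  apply: nearW => N.
  apply: (@le_trans _ _ (\sum_(0 <= i < N.+1) content_outer (G i))%E).
    by rewrite big_nat_recr//= leeDl// outer_measure_ge0.
  rewrite big_mkord big_ord_recl /=.
  apply: (@le_trans _ _ ((m (W k.+1))%:E + \sum_(i < N) (m (S (k + i)%N))%:E)%E).
    by apply: leeD; [|apply: lee_sum => i _]; exact: content_outer_open_le.
  rewrite sumEFin -EFinD lee_fin.
  have := Wtel k N; have := Ws (k + N)%N; have := Ws (k + N).+1; lra.
have bVU : (content_outer (V `&` ~` U) <= (m V - s + e / 3)%:E)%E.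
  have := WV k; rewrite addeC -leeBrDr// => /le_trans; apply.
  by rewrite -EFinB lee_fin; lra.
by apply: (le_trans (leeD aVU bVU)); rewrite -!EFinD lee_fin; lra.
Qed.

(** It suffices to cut every member of a cover of [X] along [U]: an open member is handled by the
    previous lemma, and any other member costs +oo. *)
Lemma open_content_outer_measurable (U : set T) : open U ->
  caratheodory_measurable content_outer U.
Proof.
move=> oU; apply: le_caratheodory_measurable => X.
apply: le_ereal_inf_tmp => _ [F [mF XF] <-].
have split_cost k : (content_outer (F k `&` U) + content_outer (F k `&` ~` U)
    <= open_cost (F k))%E.
  rewrite /open_cost; case: asboolP => [oF|_]; last by rewrite leey.
  exact: content_outer_open_split.
apply: (@le_trans _ _ (\sum_(k <oo) (content_outer (F k `&` U)
    + content_outer (F k `&` ~` U)))%E); last first.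
  apply: lee_nneseries => k *; last exact: split_cost.
  by rewrite adde_ge0// outer_measure_ge0.
rewrite nneseriesD; [|by move=> *; exact: outer_measure_ge0..].
have sub Y : (content_outer (X `&` Y) <= \sum_(k <oo) content_outer (F k `&` Y))%E.
  apply: le_trans (outer_measure_sigma_subadditive _ (fun k => F k `&` Y)).
  by apply: le_outer_measure => x [/XF[k _ Fx] Yx]; exists k.
by apply: leeD; exact: sub.
Qed.

Lemma borel_content_outer_measurable (A : set borel) : measurable A ->
  caratheodory_measurable content_outer A.
Proof.
move=> mA; apply: (mA (caratheodory_measurable content_outer)).
split; last exact: open_content_outer_measurable.
split; first exact: caratheodory_measurable_set0.
- by move=> B mB; rewrite setTD; exact: caratheodory_measurable_setC.
- by move=> F mF; exact: caratheodory_measurable_bigcup.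
Qed.

Lemma content_outer_semi_sigma_additive : semi_sigma_additive content_outer.
Proof.
move=> F mF tF mUF; apply: (@caratheodory_measure_sigma_additive _ _ content_outer) => //.
- by move=> k; exact: borel_content_outer_measurable.
- exact: borel_content_outer_measurable.
Qed.

Lemma content_measure_exists : exists mu : {measure set borel -> \bar R},
  (forall U : set T, open U -> (mu U <= (m U)%:E)%E) /\
  (forall C : set T, compact C -> ((m C)%:E <= mu C)%E).
Proof.
pose mixin := isMeasure.Build _ borel R content_outer
  (outer_measure0 _) (outer_measure_ge0 _) content_outer_semi_sigma_additive.
pose mu : {measure set borel -> \bar R} := HB.pack content_outer mixin.
exists mu; split; [exact: content_outer_open_le|exact: content_le_outer_compact].
Qed.

End ContentToMeasure.

(** * Extension of positive functionals *)

Section PositiveExtension.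
Context {R : realType} {T : Type}.
Variable K : set T.
Implicit Types (u v w : (T -> R) * R) (G : set ((T -> R) * R)).

Definition lin_comb (a : R) u v : (T -> R) * R :=
  ((fun x => a * u.1 x + v.1 x), a * u.2 + v.2).

(* The graph of a linear functional, defined on a subspace of functions, that is nonnegative on
   the functions nonnegative on [K]; positivity makes the graph single-valued. *)
Definition pos_graph G : Prop := [/\ G ((fun=> 0), 0),
  forall a u v, G u -> G v -> G (lin_comb a u v) &
  forall u, G u -> (forall x, K x -> 0 <= u.1 x) -> 0 <= u.2].

Lemma pos_graph_le G u v : pos_graph G -> G u -> G v ->
  (forall x, K x -> u.1 x <= v.1 x) -> u.2 <= v.2.
Proof.
move=> [_ lG pG] Gu Gv uv.
have := pG _ (lG (-1) _ _ Gu Gv); rewrite /= mulN1r addrC subr_ge0; apply=> x Kx.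
by rewrite mulN1r addrC subr_ge0 uv.
Qed.

Lemma pos_graph_scale G a u : pos_graph G -> G u ->
  G ((fun x => a * u.1 x), a * u.2).
Proof.
move=> [G0 lG _] Gu; have := lG a _ _ Gu G0; congr G.
by rewrite /lin_comb/= addr0; congr pair; apply/funext => x; rewrite addr0.
Qed.

(** The one-dimensional step of Hahn-Banach: the value at [f] is the supremum of the values at
    functions of [G] below [f] on [K]; [u0] makes this set nonempty and [v0] bounds it. *)
Lemma pos_graph_extend G (f : T -> R) u0 v0 : pos_graph G -> G u0 -> G v0 ->
  (forall x, K x -> u0.1 x <= f x <= v0.1 x) ->
  exists G' c, [/\ pos_graph G', G `<=` G' & G' (f, c)].
Proof.
move=> pgG Gu0 Gv0 uf; have [G0 lG pG] := pgG.
pose A := [set r | exists2 u, G u & (forall x, K x -> u.1 x <= f x) /\ r = u.2].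
have Au0 : A u0.2 by exists u0 => //; split=> // x /uf /andP[].
have ubA v : G v -> (forall x, K x -> f x <= v.1 x) -> ubound A v.2.
  move=> Gv fv _ [u Gu [uf' ->]]; apply: (pos_graph_le pgG) => // x Kx.
  exact: le_trans (uf' x Kx) (fv x Kx).
have hA : has_sup A.
  by split; [exists u0.2|exists v0.2; apply: ubA => // x /uf /andP[]].
pose c := sup A.
exists [set w | exists2 u, G u & exists t, w = lin_comb t (f, c) u], c; split.
- split=> /=.
  + exists ((fun=> 0), 0) => //; exists 0; rewrite /lin_comb/=; congr pair; last lra.
    by apply/funext => x; lra.
  + move=> a _ _ [u Gu [t ->]] [v Gv [s ->]].
    exists (lin_comb a u v); first exact: lG.
    exists (a * t + s); rewrite /lin_comb/=; congr pair; last lra.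
    by apply/funext => x; lra.
  + move=> _ [u Gu [t ->]] /= ge0.
    (* Dividing t f + u >= 0 by |t| makes - u / t an upper bound of [f] if t < 0 and a lower bound
       if t > 0; its value is compared with [c] accordingly. *)
    have [t0|t0|t0] := ltgtP t 0.
    * have Gv := pos_graph_scale (- t^-1) pgG Gu.
      have : c <= - t^-1 * u.2.
        apply: ge_sup; first exact: hA.1.
        apply: ubA Gv _ => x /ge0 /= h.
        have : - t^-1 * (t * f x + u.1 x) >= 0 by rewrite mulr_ge0// oppr_ge0 invr_le0 ltW.
        by rewrite mulrDr mulrA mulNr mulVf ?lt_eqF//; lra.
      move=> h; have : - t * (- t^-1 * u.2 - c) >= 0 by rewrite mulr_ge0//; lra.
      by rewrite mulrBr mulrA mulrNN divff ?lt_eqF//; lra.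
    * have Gv := pos_graph_scale (- t^-1) pgG Gu.
      have : - t^-1 * u.2 <= c.
        apply: ub_le_sup; first exact: hA.2.
        exists ((fun x => - t^-1 * u.1 x), - t^-1 * u.2) => //; split=> //= x /ge0 h.
        have : t^-1 * (t * f x + u.1 x) >= 0 by rewrite mulr_ge0// invr_ge0 ltW.
        by rewrite mulrDr mulrA mulVf ?gt_eqF//; lra.
      move=> h; have : t * (c - - t^-1 * u.2) >= 0 by rewrite mulr_ge0//; lra.
      by rewrite mulrBr mulrA mulrN divff ?gt_eqF//; lra.
    * rewrite t0 mul0r add0r; apply: pG => // x /ge0.
      by rewrite t0 mul0r add0r.
- move=> u Gu; exists u => //; exists 0; rewrite /lin_comb/= mul0r add0r.
  by case: u Gu => u1 u2 Gu; congr pair; apply/funext => x /=; lra.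
- exists ((fun=> 0), 0) => //; exists 1; rewrite /lin_comb/= mul1r addr0.
  by congr pair; apply/funext => x /=; lra.
Qed.

Definition dominated G (f : T -> R) : Prop :=
  exists2 u, G u & forall x, K x -> `|f x| <= u.1 x.

Lemma pos_graph_maximal G0 : pos_graph G0 -> exists G, [/\ pos_graph G, G0 `<=` G &
  forall f, dominated G0 f -> exists c, G (f, c)].
Proof.
move=> pG0; pose P := [set G | pos_graph (G `|` G0)].
have chain (F : set (set ((T -> R) * R))) : F `<=` P -> total_on F subset ->
    P (\bigcup_(X in F) X).
  move=> FP tF; rewrite /P /=; set U := bigcup _ _.
  (* Closure under [lin_comb] involves two elements at a time, and a chain puts both in a single
     member. *)
  have join u v : (U `|` G0) u -> (U `|` G0) v ->
      exists2 G, pos_graph G & [/\ G u, G v & G `<=` U `|` G0].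
    have sub X : F X -> X `|` G0 `<=` U `|` G0.
      by move=> FX w [Xw|]; [left; exists X|right].
    move=> [[X FX Xu]|G0u] [[Y FY Yv]|G0v].
    - have [XY|YX] := tF _ _ FX FY.
      + by exists (Y `|` G0); [exact: FP|split; [left; exact: XY|left|exact: sub]].
      + by exists (X `|` G0); [exact: FP|split; [left|left; exact: YX|exact: sub]].
    - by exists (X `|` G0); [exact: FP|split; [left|right|exact: sub]].
    - by exists (Y `|` G0); [exact: FP|split; [right|left|exact: sub]].
    - by exists G0 => //; split=> // w; right.
  split.
  - by right; case: pG0.
  - by move=> a u v /join h /h[G [_ lG _] [Gu Gv]]; apply; exact: lG.
  - by move=> u Uu; have [G [_ _ pG] [Gu _ _]] := join _ _ Uu Uu; exact: pG.
have [A [PA maxA]] := Zorn_bigcup chain.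
exists (A `|` G0); split=> [//||f [u G0u fu]]; first by move=> w; right.
have Gu : (A `|` G0) u by right.
have [|G' [c [pG' GG' G'f]]] := pos_graph_extend PA (pos_graph_scale (-1) PA Gu) Gu (f := f).
  by move=> x /fu; rewrite ler_norml /= mulN1r.
have [//|nf] := pselect (exists c, (A `|` G0) (f, c)).
have G0G' : G' `|` G0 = G' by apply/setUidl => w G0w; apply: GG'; right.
exfalso; apply: (maxA G'); last by rewrite /P /= G0G'.
split; first by move=> w Aw; apply: GG'; left.
by move=> G'A; apply: nf; exists c; left; exact: G'A.
Qed.

Lemma pos_functional_extension G0 : pos_graph G0 -> exists Lam : (T -> R) -> R,
  [/\ forall a f g, dominated G0 f -> dominated G0 g ->
        Lam (fun x => a * f x + g x) = a * Lam f + Lam g,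
      forall f, dominated G0 f -> (forall x, K x -> 0 <= f x) -> 0 <= Lam f &
      forall u, G0 u -> Lam u.1 = u.2].
Proof.
move=> pG0; have [G [pG G0G domG]] := pos_graph_maximal pG0.
have Guniq f r s : G (f, r) -> G (f, s) -> r = s.
  by move=> Gr Gs; apply/eqP; rewrite eq_le;
    rewrite (pos_graph_le pG Gr Gs)// (pos_graph_le pG Gs Gr).
(* The default 0 is the value off the domain of [G], which contains all dominated functions. *)
pose Lam f := xget 0 [set r | G (f, r)].
have LamE f r : G (f, r) -> Lam f = r.
  by move=> Gr; apply: xget_unique => // s Gs; exact: Guniq Gs Gr.
have GLam f : dominated G0 f -> G (f, Lam f).
  by move=> /domG[c Gc]; rewrite (LamE _ _ Gc).
have [_ lG ppG] := pG.
exists Lam; split.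
- by move=> a f g /GLam Gf /GLam Gg; apply: LamE; exact: (lG a _ _ Gf Gg).
- by move=> f /GLam Gf f0; exact: (ppG _ Gf f0).
- by move=> [f r] /G0G /LamE.
Qed.

End PositiveExtension.

(** * Integral representation of positive functionals *)

Lemma continuous_borel_measurable {R : realType} {T : ptopologicalType} (f : T -> R) :
  continuous f ->
  measurable_fun setT (f : g_sigma_algebraType (open : set (set T)) -> R).
Proof.
move=> /continuousP cf; apply: (measurability _ (RGenOpens.measurableE R)).
move=> _ [_ [a [b ->] <-]]; rewrite setTI; apply: sub_sigma_algebra.
exact/cf/interval_open.
Qed.

(** Discrete layer cake: for t > 0 at least t / e multiples of [e] lie in [0, t). The strict
    inequality here and the non-strict one in [layer_sum_le] are the stronger forms, so the bounds
    serve for open and for closed superlevel sets. *)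
Lemma layer_sum_ge {R : realType} (e t : R) N : 0 < e -> t <= N%:R * e ->
  t <= \sum_(j < N) e * (j%:R * e < t)%R%:R.
Proof.
move=> e0; elim: N => [|N IH]; first by rewrite big_ord0 mul0r.
rewrite big_ord_recr /= => tN1; have [tN|tN] := leP t (N%:R * e).
  by rewrite mulr0 addr0 IH.
rewrite (eq_bigr (fun=> e)) ?sumr_const ?card_ord => [|j _]; last first.
  rewrite (le_lt_trans _ tN) ?mulr1// ler_pM2r// ler_nat ltnW//.
by rewrite mulr1 -mulr_natl; move: tN1; rewrite -natr1; lra.
Qed.

Lemma layer_sum_le {R : realType} (e t : R) N : 0 < e -> 0 <= t ->
  \sum_(j < N) e * (j%:R * e <= t)%R%:R <= t + e.
Proof.
move=> e0 t0; elim: N => [|N IH]; first by rewrite big_ord0; lra.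
rewrite big_ord_recr /=; have [Nt|_] := leP (N%:R * e) t; last by rewrite mulr0 addr0.
rewrite mulr1 lerD2r (le_trans _ Nt)//.
apply: (@le_trans _ _ (\sum_(j < N) e)).
  by apply: ler_sum => j _; case: (leP (j%:R * e) t) => _; rewrite ?mulr1// mulr0 ltW.
by rewrite sumr_const card_ord mulr_natl.
Qed.

Section PositiveFunctionalMeasure.
Context {R : realType} {T : normedModType R}.
Variables (K : set T) (G : set ((T -> R) * R)) (Lam : (T -> R) -> R).
Local Notation D := (dominated K G).
Local Notation borel := (g_sigma_algebraType (open : set (set T))).

Hypothesis pG : pos_graph K G.
Hypothesis Lam_lin : forall a f g, D f -> D g ->
  Lam (fun x => a * f x + g x) = a * Lam f + Lam g.
Hypothesis Lam_ge0 : forall f, D f -> (forall x, K x -> 0 <= f x) -> 0 <= Lam f.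
Hypothesis D1 : D (fun=> 1).
Hypothesis DM : forall f g, D f -> D g -> D (fun x => f x * g x).

Lemma dominated_le f g : D g -> (forall x, K x -> `|f x| <= `|g x|) -> D f.
Proof.
move=> [u Gu gu] fg; exists u => // x Kx; exact: le_trans (fg x Kx) (gu x Kx).
Qed.

Lemma dominated_lin a f g : D f -> D g -> D (fun x => a * f x + g x).
Proof.
move=> [u Gu fu] [v Gv gv]; exists (lin_comb `|a| u v).
  by have [_ lG _] := pG; exact: lG.
move=> x Kx; apply: (le_trans (ler_normD _ _)); rewrite /= normrM.
by apply: lerD; [exact/ler_wpM2l/fu|exact: gv].
Qed.

Lemma dominated0 : D (fun=> 0).
Proof. by apply: (dominated_le D1) => x _; rewrite normr0. Qed.

Lemma dominated_scale a f : D f -> D (fun x => a * f x).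
Proof.
by move=> Df; apply: (dominated_le (dominated_lin a Df dominated0)) => x _; rewrite addr0.
Qed.

Lemma dominated_sum N (F : nat -> T -> R) : (forall j, D (F j)) ->
  D (fun x => \sum_(j < N) F j x).
Proof.
move=> DF; elim: N => [|N IH].
  by apply: (dominated_le dominated0) => x _; rewrite big_ord0.
by apply: (dominated_le (dominated_lin 1 IH (DF N))) => x _; rewrite mul1r big_ord_recr.
Qed.

Lemma dominated_indic (A : set T) : D (\1_A).
Proof.
by apply: (dominated_le D1) => x _; rewrite indicE; case: (x \in A); rewrite ?normr0// normr1.
Qed.

Lemma Lam_le f g : D f -> D g -> (forall x, K x -> f x <= g x) -> Lam f <= Lam g.
Proof.
move=> Df Dg fg; have Dfg := dominated_lin (-1) Df Dg.
have : 0 <= Lam (fun x => -1 * f x + g x).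
  by apply: Lam_ge0 => // x /fg; lra.
by rewrite Lam_lin//; lra.
Qed.

Lemma Lam_eq f g : D f -> D g -> (forall x, K x -> f x = g x) -> Lam f = Lam g.
Proof.
move=> Df Dg fg; apply/eqP; rewrite eq_le.
by apply/andP; split; apply: Lam_le => // x /fg ->.
Qed.

Lemma Lam0 : Lam (fun=> 0) = 0.
Proof.
have := Lam_lin (-1) dominated0 dominated0.
have -> : (fun x : T => -1 * 0 + 0) = (fun=> 0) :> (T -> R) by apply/funext => x; lra.
lra.
Qed.

Lemma Lam_scale a f : D f -> Lam (fun x => a * f x) = a * Lam f.
Proof.
move=> Df; have := Lam_lin a Df dominated0; rewrite Lam0 addr0 => <-.
apply: Lam_eq; [exact: dominated_scale|exact: (dominated_lin a Df dominated0)|].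
by move=> x _; rewrite addr0.
Qed.

Lemma Lam_sum N (F : nat -> T -> R) : (forall j, D (F j)) ->
  Lam (fun x => \sum_(j < N) F j x) = \sum_(j < N) Lam (F j).
Proof.
move=> DF; elim: N => [|N IH].
  rewrite big_ord0 -[RHS]Lam0; apply: Lam_eq; [exact: (dominated_sum 0 DF)|exact: dominated0|].
  by move=> x _; rewrite big_ord0.
have DS := dominated_sum N DF; rewrite big_ord_recr /= -IH -[in RHS](mul1r (Lam _)) -Lam_lin//.
apply: Lam_eq; [exact: (dominated_sum N.+1 DF)|exact: (dominated_lin 1 DS (DF N))|].
by move=> x _; rewrite big_ord_recr mul1r.
Qed.

Definition Lam_content (A : set T) : R := Lam (\1_A).

Lemma Lam_content_ge0 A : 0 <= Lam_content A.
Proof.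
by apply: Lam_ge0 => [|x _]; [exact: dominated_indic|rewrite indicE].
Qed.

Lemma Lam_contentU A B : A `&` B = set0 ->
  Lam_content (A `|` B) = Lam_content A + Lam_content B.
Proof.
move=> AB; rewrite /Lam_content -[X in _ = X + _]mul1r -Lam_lin; try exact: dominated_indic.
congr Lam; apply/funext => x; rewrite mul1r !indicE in_setU.
have [xA|xA] := boolP (x \in A); have [xB|xB] := boolP (x \in B); rewrite ?addr0 ?add0r//.
have : set0 x by rewrite -AB; split; exact: set_mem.
by [].
Qed.

Lemma Lam_content_setCK : Lam_content (~` K) = 0.
Proof.
rewrite /Lam_content -[RHS]Lam0; apply: Lam_eq; [exact: dominated_indic|exact: dominated0|].
by move=> x Kx; rewrite indicE memNset.
Qed.

Section Integral.
Variable mu : {measure set borel -> \bar R}.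
Hypothesis mu_open : forall U : set T, open U -> (mu U <= (Lam_content U)%:E)%E.
Hypothesis mu_compact : forall C : set T, compact C -> ((Lam_content C)%:E <= mu C)%E.

Let M := Lam_content setT.

(** The superlevel sets [U j] are open, so [mu_open] bounds each layer of the integral. [Lam] is
    only finitely additive, hence it is applied to finite partial sums, which are at most f + e. *)
Lemma integral_le_Lam (f : T -> R) : continuous f -> (forall x, 0 <= f x) -> D f ->
  (\int[mu]_x (f x)%:E <= (Lam f)%:E)%E.
Proof.
move=> cf f0 Df.
have M0 : 0 <= M by exact: Lam_content_ge0.
suff main (e : R) : 0 < e -> (\int[mu]_x (f x)%:E <= (Lam f + e * M)%:E)%E.
  (* The denominator is [M + 1] because [M] may be 0. *)
  apply/lee_addgt0Pr => e e0; have e'0 : 0 < e / (M + 1) by rewrite divr_gt0//; lra.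
  apply: (le_trans (main _ e'0)); rewrite -EFinD lee_fin lerD2l.
  have -> : e / (M + 1) * M = e - e / (M + 1) by field; lra.
  lra.
move=> e0; pose U j := [set x | j%:R * e < f x].
have oU j : open (U j).
  by move/continuousP: cf => /(_ [set y | j%:R * e < y]); apply; exact: open_gt.
have mU j : measurable (U j : set borel) by exact: sub_sigma_algebra.
have inU j x : (x \in U j) = (j%:R * e < f x).
  by apply/idP/idP => [/set_mem|] //; exact: mem_set.
have mind j : measurable_fun setT (fun x : borel => (e * \1_(U j) x)%:E).
  by apply/measurable_EFinP; apply: measurable_funM => //; exact: measurable_indic.
have ind0 j (x : borel) : (0 <= (e * \1_(U j) x)%:E)%E.
  by rewrite lee_fin mulr_ge0// ?ltW// indicE.
apply: (@le_trans _ _ (\int[mu]_x (\sum_(j <oo) (e * \1_(U j) x)%:E))%E).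
  apply: ge0_le_integral => //.
  - by move=> x _; rewrite lee_fin.
  - by apply/measurable_EFinP; exact: continuous_borel_measurable.
  - by apply: (@ge0_emeasurable_sum _ _ _ _ _ xpredT).
  - move=> x _; pose N := (Num.truncn (f x / e)).+1.
    apply: (@le_trans _ _ (\sum_(0 <= j < N) (e * \1_(U j) x)%:E)%E); last first.
      by apply: nneseries_lim_ge => j *; exact: ind0.
    rewrite sumEFin lee_fin big_mkord.
    have : f x <= N%:R * e by rewrite -ler_pdivrMr// ltW// truncnS_gt.
    move=> /(layer_sum_ge e0) /le_trans; apply; apply: ler_sum => j _.
    by rewrite indicE inU.
rewrite integral_nneseries//.
apply: lime_le.
  by apply: is_cvg_nneseries => j *; apply: integral_ge0 => x _; exact: ind0.
apply: nearW => N.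
apply: (@le_trans _ _ (\sum_(0 <= j < N) (e * Lam_content (U j))%:E)%E).
  apply: lee_sum => j _; under eq_integral do rewrite EFinM.
  rewrite ge0_integralZl//; [|exact/measurable_EFinP/measurable_indic|].
    rewrite integral_indic// setIT EFinM lee_pmul2l//; exact: mu_open.
  by rewrite lee_fin ltW.
rewrite sumEFin lee_fin big_mkord.
have DU j : D (fun x => e * \1_(U j) x) by exact/dominated_scale/dominated_indic.
rewrite (eq_bigr (fun j : 'I_N => Lam (fun x => e * \1_(U j) x))); last first.
  by move=> j _; rewrite Lam_scale//; exact: dominated_indic.
rewrite -(Lam_sum N DU) addrC -Lam_lin//; last exact: dominated_indic.
apply: Lam_le; [exact: (dominated_sum N DU)|apply: dominated_lin => //; exact: dominated_indic|].
move=> x _; rewrite indicT mulr1 addrC.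
apply: le_trans (layer_sum_le N e0 (f0 x)); apply: ler_sum => j _.
rewrite indicE inU; apply: ler_wpM2l; first exact: ltW.
by case: (ltgtP (j%:R * e) (f x)).
Qed.

(** [mu] dominates the content on compact sets only, so the superlevel sets are cut by the compact
    set g <= r. The loss is at most Lam h / r, which tends to 0 as [N] grows with [e] fixed. *)
Lemma Lam_le_integral (f g : T -> R) : continuous f -> (forall x, 0 <= f x) -> D f ->
  continuous g -> (forall x, 0 <= g x) -> D g -> (forall r, compact [set x | g x <= r]) ->
  ((Lam f)%:E <= \int[mu]_x (f x)%:E)%E.
Proof.
move=> cf f0 Df cg g0 Dg compg.
have M0 : 0 <= M by exact: Lam_content_ge0.
have mf : measurable_fun setT (fun x : borel => (f x)%:E).
  by apply/measurable_EFinP; exact: continuous_borel_measurable.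
have muT : (mu setT <= M%:E)%E by exact/mu_open/openT.
have Dff := DM Df Df; have Dfg := DM Df Dg.
(* With r := N * e, h / r dominates f wherever r < g or r < f, and the layer sum does elsewhere. *)
pose h x := f x * f x + f x * g x.
have Dh : D h.
  have := dominated_lin 1 Dff Dfg; congr (D _).
  by apply/funext => x; rewrite mul1r.
have h0 x : 0 <= h x by rewrite addr_ge0// mulr_ge0.
have C0 : 0 <= Lam h by exact: Lam_ge0.
suff main (e : R) N : 0 < e -> (0 < N)%N ->
    ((Lam f)%:E <= \int[mu]_x (f x)%:E + (e * M + (N%:R * e)^-1 * Lam h)%:E)%E.
  (* The mesh [d] brings d * M below e / 2; [N] is then chosen so that the tail term is below e / 2
     as well. *)
  apply/lee_addgt0Pr => e e0; pose d := e / 2 / (M + 1).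
  have d0 : 0 < d by rewrite !divr_gt0//; lra.
  pose N := (Num.truncn (Lam h / d / (e / 2))).+1.
  have hN : Lam h / d / (e / 2) < N%:R by exact: truncnS_gt.
  apply: (le_trans (main d N d0 isT)); apply: leeD2l; rewrite lee_fin.
  have -> : e = e / 2 + e / 2 by lra.
  apply: lerD.
    have -> : d * M = e / 2 - d by rewrite /d; field; lra.
    lra.
  rewrite invfM -mulrA mulrC ler_pdivrMr ?ltr0n// mulrC [e / 2 * _]mulrC.
  by rewrite -ler_pdivrMr ?ltW//; lra.
move=> e0 N0; pose r := N%:R * e; have r0 : 0 < r by rewrite mulr_gt0// ltr0n.
have clf a : closed [set x | a <= f x].
  by move/continuous_closedP: cf => /(_ [set y | a <= y]); apply; exact: closed_ge.
have clg a : closed [set x | g x <= a].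
  by move/continuous_closedP: cg => /(_ [set y | y <= a]); apply; exact: closed_le.
pose A j := [set x | g x <= r] `&` [set x | j%:R * e <= f x].
have cA j : compact (A j) by exact: compact_closedI.
have mA j : measurable (A j : set borel).
  rewrite -[A j]setCK; apply: measurableC; apply: sub_sigma_algebra.
  by rewrite /= openC; exact: closedI.
have ind0 j (x : borel) : (0 <= (e * \1_(A j) x)%:E)%E.
  by rewrite lee_fin mulr_ge0// ?ltW// indicE.
have mind j : measurable_fun setT (fun x : borel => (e * \1_(A j) x)%:E).
  by apply/measurable_EFinP; apply: measurable_funM => //; exact: measurable_indic.
have DA j : D (fun x => e * \1_(A j) x) by exact/dominated_scale/dominated_indic.
have DS := dominated_sum N DA.
have : Lam f <= \sum_(j < N) e * Lam_content (A j) + r^-1 * Lam h.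
  rewrite (eq_bigr (fun j : 'I_N => Lam (fun x => e * \1_(A j) x))); last first.
    by move=> j _; rewrite Lam_scale//; exact: dominated_indic.
  rewrite -(Lam_sum N DA) addrC -Lam_lin//.
  apply: Lam_le => //; first exact: (dominated_lin r^-1 Dh DS).
  move=> x _; have S0 : 0 <= \sum_(j < N) e * \1_(A j) x.
    by apply: sumr_ge0 => j _; have := ind0 j x; rewrite lee_fin.
  have [rg|gr] := ltP r (g x).
    have : r * f x <= h x by rewrite /h; have := f0 x; nra.
    by rewrite -ler_pdivlMl//; lra.
  have [rf|fr] := ltP r (f x).
    have : r * f x <= h x by rewrite /h; have := f0 x; have := g0 x; nra.
    by rewrite -ler_pdivlMl//; lra.
  have : 0 <= r^-1 * h x by rewrite mulr_ge0// invr_ge0 ltW.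
  suff : f x <= \sum_(j < N) e * \1_(A j) x by lra.
  apply: (le_trans (layer_sum_ge e0 fr)); apply: ler_sum => j _.
  rewrite indicE; apply: ler_wpM2l; first exact: ltW.
  case: (ltP (j%:R * e) (f x)) => //= jf.
  by rewrite mem_set//; split=> //=; exact: ltW.
rewrite -lee_fin EFinD => /le_trans; apply.
rewrite EFinD addeA leeD2r//.
apply: (@le_trans _ _ (\int[mu]_x \sum_(j < N) (e * \1_(A j) x)%:E)%E).
  rewrite ge0_integral_sum//.
  rewrite -sumEFin; apply: lee_sum => j _.
  under eq_integral do rewrite EFinM.
  rewrite ge0_integralZl//; [|exact/measurable_EFinP/measurable_indic|].
    rewrite integral_indic// setIT EFinM lee_pmul2l//; exact: mu_compact.
  by rewrite lee_fin ltW.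
apply: (@le_trans _ _ (\int[mu]_x ((f x)%:E + e%:E))%E).
  apply: ge0_le_integral => //.
  - by move=> x _; apply: sume_ge0 => j _; exact: ind0.
  - by apply: emeasurable_sum => j; exact: mind.
  - by apply: emeasurable_funD => //; exact: measurable_cst.
  move=> x _; rewrite sumEFin -EFinD lee_fin.
  apply: le_trans (layer_sum_le N e0 (f0 x)); apply: ler_sum => j _.
  rewrite indicE; apply: ler_wpM2l; first exact: ltW.
  have [/set_mem[_ /= ->]//|_] := boolP (x \in A j).
  by case: (_ <= f x).
rewrite ge0_integralD//; last 2 first.
- by move=> x _; rewrite lee_fin.
- by move=> x _; rewrite lee_fin ltW.
by rewrite leeD2l// integral_cst// EFinM lee_pmul2l.
Qed.

(** Positive and negative parts of a dominated function stay dominated, although those of a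
    polynomial are in general not polynomials; the two inequalities apply to each part. *)
Lemma integral_eq_Lam (g : T -> R) :
  continuous g -> (forall x, 0 <= g x) -> D g -> (forall r, compact [set x | g x <= r]) ->
  forall f : T -> R, continuous f -> D f ->
  mu.-integrable setT (fun x : borel => (f x)%:E) /\ (Lam f)%:E = (\int[mu]_x (f x)%:E)%E.
Proof.
move=> cg g0 Dg compg.
have ge0 (f : T -> R) : continuous f -> (forall x, 0 <= f x) -> D f ->
    (Lam f)%:E = (\int[mu]_x (f x)%:E)%E.
  move=> cf f0 Df; apply/eqP; rewrite eq_le.
  by rewrite (Lam_le_integral cf f0 Df cg g0 Dg compg) (integral_le_Lam cf f0 Df).
have int_ge0 (f : T -> R) : continuous f -> (forall x, 0 <= f x) -> D f ->
    mu.-integrable setT (fun x : borel => (f x)%:E).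
  move=> cf f0 Df; apply/integrableP; split.
    by apply/measurable_EFinP; exact: continuous_borel_measurable.
  under eq_integral do rewrite gee0_abs ?lee_fin//.
  by rewrite -ge0// ltry.
move=> f cf Df.
pose fp x := Num.max (f x) 0; pose fn x := Num.max (- f x) 0.
have cfp : continuous fp.
  by move=> x; apply: (@continuous_max _ _ f (fun=> 0)); [exact: cf|exact: cvg_cst].
have cfn : continuous fn.
  move=> x; apply: (@continuous_max _ _ (fun x => - f x) (fun=> 0)); last exact: cvg_cst.
  exact/continuousN/cf.
have fp0 x : 0 <= fp x by rewrite le_max lexx orbT.
have fn0 x : 0 <= fn x by rewrite le_max lexx orbT.
have Dfp : D fp.
  apply: (dominated_le Df) => x _; rewrite /fp; case: (leP (f x) 0) => _ //.
  by rewrite normr0.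
have Dfn : D fn.
  apply: (dominated_le Df) => x _; rewrite /fn; case: (leP (- f x) 0) => _ //.
    by rewrite normr0.
  by rewrite normrN.
have fE : f = (fun x => -1 * fn x + fp x).
  apply/funext => x; rewrite /fn /fp; case: (leP (f x) 0) => fx; case: (leP (- f x) 0) => nfx; lra.
have If := int_ge0 _ cfn fn0 Dfn; have Ip := int_ge0 _ cfp fp0 Dfp.
have E x : (f x)%:E = ((fp x)%:E - (fn x)%:E)%E.
  by rewrite -EFinB; congr EFin; rewrite [in LHS]fE; lra.
split.
  rewrite (_ : (fun x : borel => (f x)%:E) = (fun x : borel => (fp x)%:E - (fn x)%:E)%E).
    exact: integrableB.
  by apply/funext => x; rewrite E.
under eq_integral do rewrite E.
rewrite integralB// -!ge0// -EFinB; congr EFin.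
by rewrite [in LHS]fE Lam_lin//; lra.
Qed.

End Integral.
End PositiveFunctionalMeasure.

Lemma pos_graph_measure {R : realType} {T : normedModType R} (K : set T)
    (G : set ((T -> R) * R)) (g : T -> R) :
  closed K -> pos_graph K G -> dominated K G (fun=> 1) ->
  (forall f h, dominated K G f -> dominated K G h -> dominated K G (fun x => f x * h x)) ->
  continuous g -> (forall x, 0 <= g x) -> dominated K G g ->
  (forall r, compact [set x | g x <= r]) ->
  exists mu : {measure set (g_sigma_algebraType (open : set (set T))) -> \bar R},
    mu (~` K) = 0%E /\
    forall u, G u -> continuous u.1 -> dominated K G u.1 ->
      mu.-integrable setT (fun x : g_sigma_algebraType (open : set (set T)) => (u.1 x)%:E) /\
      (u.2)%:E = (\int[mu]_x (u.1 x)%:E)%E.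
Proof.
move=> cK pG D1 DM cg g0 Dg compg.
have [Lam [Lam_lin Lam_ge0 LamG]] := pos_functional_extension pG.
have [mu [mu_open mu_compact]] := content_measure_exists
  (Lam_content_ge0 Lam_ge0 D1) (Lam_contentU Lam_lin D1).
exists mu; split.
  apply/eqP; rewrite eq_le measure_ge0 andbT.
  (* The complement of [K] is open and its indicator vanishes on [K], where alone [Lam] sees it. *)
  apply: (le_trans (mu_open _ (closed_openC cK))).
  by rewrite (Lam_content_setCK pG Lam_lin Lam_ge0 D1).
move=> u Gu cu Du; rewrite -(LamG _ Gu).
exact: (integral_eq_Lam pG Lam_lin Lam_ge0 D1 DM mu_open mu_compact cg g0 Dg compg cu Du).
Qed.

(** * Haviland's theorem *)

Lemma continuous_prod {R : realType} {T : topologicalType} {I : Type} (r : seq I)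
    (F : I -> T -> R) :
  (forall i, continuous (F i)) -> continuous (fun x => \prod_(i <- r) F i x).
Proof.
move=> cF; elim: r => [|i r IH].
  have -> : (fun x : T => \prod_(i <- [::]) F i x) = (fun=> 1).
    by apply/funext => z; rewrite big_nil.
  exact: cst_continuous.
have -> : (fun x : T => \prod_(i <- i :: r) F i x) =
    (fun x => F i x * \prod_(i <- r) F i x).
  by apply/funext => z; rewrite big_cons.
by move=> x; exact: (continuousM (cF i x) (IH x)).
Qed.

Lemma continuous_sum {R : realType} {T : topologicalType} {I : Type} (r : seq I)
    (F : I -> T -> R) :
  (forall i, continuous (F i)) -> continuous (fun x => \sum_(i <- r) F i x).
Proof.
move=> cF; elim: r => [|i r IH].
  have -> : (fun x : T => \sum_(i <- [::]) F i x) = (fun=> 0).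
    by apply/funext => z; rewrite big_nil.
  exact: cst_continuous.
have -> : (fun x : T => \sum_(i <- i :: r) F i x) =
    (fun x => F i x + \sum_(i <- r) F i x).
  by apply/funext => z; rewrite big_cons.
by move=> x; exact: (continuousD (cF i x) (IH x)).
Qed.

Section Polynomials.
Context {R : realType} {n : nat}.
Implicit Types (p : {mpoly R[n]}) (s : 'X_{1..n} -> R) (x y : 'rV[R]_n).

(** Allows polynomials with different supports to be summed over a common list, as linearity
    requires. *)
Lemma rieszE s p (r : seq 'X_{1..n}) : uniq r -> {subset msupp p <= r} ->
  riesz s p = \sum_(m <- r) p@_m * s m.
Proof.
move=> ur sr; rewrite [RHS](bigID (mem (msupp p))) /= [X in _ + X]big1 ?addr0; last first.
  by move=> m /memN_msupp_eq0 ->; rewrite mul0r.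
rewrite -big_filter; apply: perm_big; apply: uniq_perm.
- exact: msupp_uniq.
- exact: filter_uniq.
- by move=> m; rewrite mem_filter; case: (boolP (m \in msupp p)) => //= /sr ->.
Qed.

Lemma riesz_lin s a p q : riesz s (a *: p + q) = a * riesz s p + riesz s q.
Proof.
pose r := undup (msupp p ++ msupp q ++ msupp (a *: p + q)).
have ur : uniq r by exact: undup_uniq.
rewrite !(@rieszE s _ r)//; try by move=> m; rewrite mem_undup !mem_cat => ->; rewrite ?orbT.
rewrite big_distrr -big_split /=; apply: eq_bigr => m _.
by rewrite mcoeffD mcoeffZ mulrDl mulrA.
Qed.

Lemma rieszX s m : riesz s 'X_[m] = s m.
Proof. by rewrite /riesz msuppX big_seq1 mcoeffX eqxx mul1r. Qed.

Lemma riesz0 s : riesz s 0 = 0.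
Proof. by rewrite /riesz msupp0 big_nil. Qed.

(** Makes the lemmas on [riesz] available for evaluation; both sides unfold to the same sum. *)
Lemma peval_riesz p x : peval p x = riesz (fun m => mono m x) p.
Proof. by []. Qed.

Lemma pevalX m x : peval 'X_[m] x = mono m x.
Proof. by rewrite peval_riesz rieszX. Qed.

Lemma continuous_mono m : continuous (@mono R n m).
Proof.
apply: continuous_prod => i x.
apply: (@continuous_comp _ _ _ (fun z : 'rV[R]_n => z ord0 i) (fun t => t ^+ mexp m i)).
  exact: coord_continuous.
exact: exprn_continuous.
Qed.

Lemma continuous_peval p : continuous (peval p).
Proof.
apply: continuous_sum => m x; apply: (@continuousM _ _ (fun=> p@_m) (mono m)).
  exact: cst_continuous.
exact: continuous_mono.
Qed.

Definition sqnorm : {mpoly R[n]} := \sum_(i < n) 'X_i ^+ 2.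

Lemma sqnormE x : peval sqnorm x = \sum_(i < n) x ord0 i ^+ 2.
Proof.
rewrite /peval /sqnorm raddf_sum /=; apply: eq_bigr => i _.
by rewrite rmorphXn /= mevalXU.
Qed.

Lemma sqnorm_ge0 x : 0 <= peval sqnorm x.
Proof. by rewrite sqnormE sumr_ge0// => i _; exact: sqr_ge0. Qed.

Lemma compact_sqnorm_le r : compact [set x | peval sqnorm x <= r].
Proof.
apply: bounded_closed_compact.
  (* The bound [1 + r] avoids a square root: t^2 <= r implies |t| <= 1 + r. *)
  exists (1 + r); split; first exact: num_real.
  move=> b rb x /= xr; rewrite [leLHS]/Num.norm /= mx_normrE.
  apply/bigmax_leP; split=> [|[i j] _ /=]; first by have := sqnorm_ge0 x; lra.
  have : x i j ^+ 2 <= r.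
    rewrite (le_trans _ xr)// sqnormE (bigD1 j)//= (ord1 i) lerDl.
    by rewrite sumr_ge0// => k _; exact: sqr_ge0.
  move=> xijr; have r0 : 0 <= r by rewrite (le_trans _ xijr)// sqr_ge0.
  by rewrite ler_norml; apply/andP; split; nra.
have /continuous_closedP /(_ [set y | y <= r]) := @continuous_peval sqnorm.
by apply; exact: closed_le.
Qed.

(** The graph of the Riesz functional on polynomial functions is positive by assumption. Products of
    dominating polynomials dominate products, and [sqnorm] is the function with compact sublevel
    sets. *)
Lemma haviland (K : set 'rV[R]_n) s : closed K ->
  (forall p, (forall x, K x -> 0 <= peval p x) -> 0 <= riesz s p) -> is_moment_seq K s.
Proof.
move=> cK s_ge0.
pose G : set (('rV[R]_n -> R) * R) := [set u | exists p, u = (peval p, riesz s p)].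
have Gp p : G (peval p, riesz s p) by exists p.
have dom p q : (forall x, K x -> `|peval p x| <= peval q x) -> dominated K G (peval p).
  by move=> pq; exists (peval q, riesz s q).
have pG : pos_graph K G.
  split.
  - by exists 0; rewrite riesz0; congr pair; apply/funext => x; rewrite /peval meval0.
  - move=> a _ _ [p ->] [q ->]; exists (a *: p + q); rewrite /lin_comb/= riesz_lin.
    by congr pair; apply/funext => x; rewrite !peval_riesz riesz_lin.
  - by move=> _ [p ->]; exact: s_ge0.
have D1 : dominated K G (fun=> 1).
  exists (peval 1, riesz s 1) => // x _ /=.
  by rewrite /peval meval1 normr1.
have DM f h : dominated K G f -> dominated K G h -> dominated K G (fun x => f x * h x).
  move=> [_ [p ->] fp] [_ [q ->] hq]; exists (peval (p * q), riesz s (p * q)) => // x Kx.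
  by rewrite /= /peval mevalM normrM ler_pM//; [exact: fp|exact: hq].
have Dg : dominated K G (peval sqnorm).
  by apply: (dom _ sqnorm) => x _; rewrite ger0_norm// sqnorm_ge0.
have [mu [mu0 muE]] := pos_graph_measure cK pG D1 DM (@continuous_peval sqnorm)
  sqnorm_ge0 Dg compact_sqnorm_le.
exists mu; split=> // a.
have Dmono : dominated K G (peval 'X_[a]).
  (* A monomial may change sign, so it is dominated through |t| <= 1 + t^2. *)
  apply: (dom _ (1 + 'X_[a] ^+ 2)) => x _.
  rewrite /peval mevalD meval1 rmorphXn /=; set t := meval _ _.
  by rewrite ler_norml; apply/andP; split; nra.
have := muE _ (Gp 'X_[a]) (@continuous_peval 'X_[a]) Dmono.
rewrite /= rieszX (_ : peval 'X_[a] = @mono R n a)//.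
by apply/funext => x; rewrite pevalX.
Qed.

End Polynomials.

(** * Taylor's formula *)

Section Taylor.
Context {R : realType} {n : nat}.
Implicit Types (p : {mpoly R[n]}) (s : 'X_{1..n} -> R) (x y : 'rV[R]_n).

Definition translation y : n.-tuple {mpoly R[n]} :=
  [tuple 'X_i + (y ord0 i)%:MP | i < n].

Lemma peval_translation p x y : peval (p \mPo translation y) x = peval p (x + y).
Proof.
rewrite /peval comp_mpoly_meval; apply: meval_eq => i.
by rewrite tnth_mktuple mevalD mevalXU mevalC mxE.
Qed.

Lemma translationK y m : ('X_[m] \mPo translation (- y)) \mPo translation y = 'X_[m].
Proof.
rewrite comp_mpolyX rmorph_prod [RHS]mpolyXE_id; apply: eq_bigr => i _.
rewrite rmorphXn tnth_mktuple /= rmorphD /= comp_mpolyC comp_mpolyXU.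
by rewrite -tnth_nth tnth_mktuple -addrA -mpolyCD mxE addrN mpolyC0 addr0.
Qed.

Lemma mnm_ofE d (f : {ffun 'I_n -> 'I_d}) i : mnm_of f i = f i.
Proof. by rewrite multinomE tnth_mktuple. Qed.

Lemma mfact_gt0 (a : 'X_{1..n}) : (0 < mfact a)%N.
Proof. by rewrite /mfact prodn_gt0// => i; exact: fact_gt0. Qed.

(** The added binomial coefficients vanish. A range [d] common to all variables lets the product of
    the expansions distribute into one sum over [{ffun 'I_n -> 'I_d}]. *)
Lemma exprDn_widen (A : comNzRingType) (a b : A) k d : (k < d)%N ->
  (a + b) ^+ k = \sum_(i < d) (a ^+ (k - i) *+ 'C(k, i)) * b ^+ i.
Proof.
move=> kd; rewrite exprDn (big_ord_widen d (fun i => a ^+ (k - i) * b ^+ i *+ 'C(k, i)) kd).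
rewrite big_mkcond; apply: eq_bigr => i _; rewrite mulrnAl ltnS.
by case: leqP => // ki; rewrite bin_small// mulr0n.
Qed.

Lemma taylorX d y (m : 'X_{1..n}) : (forall i, m i < d)%N ->
  'X_[m] \mPo translation y = \sum_(f : {ffun 'I_n -> 'I_d})
    (peval ('X_[m]^`M[mnm_of f]) y / (mfact (mnm_of f))%:R) *: 'X_[mnm_of f].
Proof.
move=> md; rewrite comp_mpolyX.
under eq_bigr => i _ do rewrite tnth_mktuple addrC (exprDn_widen _ _ (md i)).
rewrite bigA_distr_bigA; apply: eq_bigr => f _.
rewrite big_split /= [X in _ = _ *: X]mpolyXE_id.
under [X in _ = _ *: X]eq_bigr => i _ do rewrite mnm_ofE.
rewrite -mul_mpolyC; congr (_ * _).
rewrite mderivmX /peval mevalZ mevalX /mfact !natr_prod mulrAC -prodf_div.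
rewrite -big_split /= rmorph_prod; apply: eq_bigr => i _.
rewrite -rmorphXn -rmorphMn /=; congr mpolyC.
rewrite mnmBE mnm_ofE (_ : mexp (mnm_of f) i = f i); last exact: mnm_ofE.
(* A falling factorial divided by the factorial is the binomial coefficient. *)
rewrite -bin_ffact natrM mulfK ?pnatr_eq0 -?lt0n ?fact_gt0//.
by rewrite mulr_natl.
Qed.

(** By linearity it suffices to treat the monomials of [p]; all their exponents are below
    [degbound p], the index range used in [diffop]. *)
Lemma taylor p y : p \mPo translation y =
  \sum_(f : {ffun 'I_n -> 'I_(degbound p)})
    (peval (p^`M[mnm_of f]) y / (mfact (mnm_of f))%:R) *: 'X_[mnm_of f].
Proof.
have md m i : m \in msupp p -> (m i < degbound p)%N.
  move=> mp; rewrite /degbound ltnS (leq_trans _ (leq_bigmax_seq _ mp _))//.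
  by rewrite mdegE (bigD1 i)//= leq_addr.
rewrite [in LHS](mpolyE p) raddf_sum /=.
under [RHS]eq_bigr => f _.
  rewrite [X in X^`M[_]](mpolyE p) (raddf_sum (mderivm _)) /= /peval raddf_sum /= big_distrl /=.
  rewrite scaler_suml.
  over.
rewrite exchange_big /=; apply: eq_big_seq => m mp.
rewrite comp_mpolyZ (taylorX y (fun i => md m i mp)) scaler_sumr; apply: eq_bigr => f _.
by rewrite mderivmZ mevalZ scalerA mulrA.
Qed.

Lemma riesz_sum (I : Type) (r : seq I) s (F : I -> {mpoly R[n]}) :
  riesz s (\sum_(i <- r) F i) = \sum_(i <- r) riesz s (F i).
Proof.
elim: r => [|i r IH]; first by rewrite !big_nil riesz0.
by rewrite !big_cons -[F i]scale1r riesz_lin mul1r IH scale1r.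
Qed.

Lemma rieszZ s a p : riesz s (a *: p) = a * riesz s p.
Proof. by rewrite -[a *: p]addr0 riesz_lin riesz0 addr0. Qed.

(** The factorial in the sequence cancels the denominator in Taylor's formula. *)
Lemma peval_diffop (q : 'X_{1..n} -> {mpoly R[n]}) p y :
  peval (diffop q p) y =
  riesz (fun a => (mfact a)%:R * peval (q a) y) (p \mPo translation y).
Proof.
rewrite taylor riesz_sum /diffop /peval raddf_sum /=; apply: eq_bigr => f _.
rewrite rieszZ rieszX mevalM /peval mulrA mulrC divfK//.
by rewrite pnatr_eq0 -lt0n mfact_gt0.
Qed.

End Taylor.

(** * Moment sequences *)

Section Moments.
Context {R : realType} {n : nat}.
Implicit Types (p : {mpoly R[n]}) (s : 'X_{1..n} -> R) (x y : 'rV[R]_n).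
Local Notation borel := (borelRn R n).

Lemma integral_peval (mu : {measure set borel -> \bar R}) s p :
  (forall a, mu.-integrable setT (fun x : borel => (mono a x)%:E) /\
     (s a)%:E = (\int[mu]_x (mono a x)%:E)%E) ->
  mu.-integrable setT (fun x : borel => (peval p x)%:E) /\
  (riesz s p)%:E = (\int[mu]_x (peval p x)%:E)%E.
Proof.
move=> mus.
have E x : (peval p x)%:E = (\sum_(m <- msupp p) (p@_m)%:E * (mono m x)%:E)%E.
  rewrite peval_riesz /riesz -sumEFin; apply: eq_bigr => m _.
  by rewrite EFinM.
have I m : mu.-integrable setT (fun x : borel => (p@_m)%:E * (mono m x)%:E)%E.
  by apply: integrableZl => //; exact: (mus m).1.
split.
  rewrite (_ : (fun x : borel => _) = fun x : borel =>
      (\sum_(m <- msupp p) (p@_m)%:E * (mono m x)%:E)%E); last first.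
    by apply/funext => x; exact: E.
  exact: integrable_sum.
under eq_integral do rewrite E.
rewrite integral_sum// /riesz -sumEFin; apply: eq_bigr => m _.
by rewrite integralZl//; [rewrite -(mus m).2 EFinM|exact: (mus m).1].
Qed.

Lemma moment_seq_riesz_ge0 (K : set 'rV[R]_n) s p : closed K -> is_moment_seq K s ->
  (forall x, K x -> 0 <= peval p x) -> 0 <= riesz s p.
Proof.
move=> cK [mu [mu0 mus]] p0.
have [/measurable_int mp sp] := integral_peval p mus.
(* [p] may be negative off [K], but that set is null, so [p] may be replaced by its absolute value
   under the integral. *)
rewrite -lee_fin sp (@ae_eq_integral _ _ _ mu setT (fun x : borel => `|(peval p x)%:E|%E))//.
- by apply: integral_ge0 => x _; exact: abse_ge0.
- exact: measurableT_comp.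
exists (~` K); split=> //.
  by apply: sub_sigma_algebra; exact: closed_openC.
move=> x /= nx Kx; apply: nx => _.
by rewrite /= ger0_norm// p0.
Qed.

Lemma dirac_moment_seq (K : set 'rV[R]_n) y : K y -> is_moment_seq K (fun a => mono a y).
Proof.
move=> Ky; exists (\d_(y : borel)); split.
  by rewrite /= /dirac indicE memNset.
move=> a; have ma : measurable_fun setT (fun x : borel => (mono a x)%:E).
  apply/measurable_EFinP; apply: (@continuous_borel_measurable R 'rV[R]_n (mono a)).
  exact: continuous_mono.
have muE (f : borel -> \bar R) : measurable_fun setT f -> (\int[\d_(y : borel)]_x f x)%E = f y.
  by move=> mf; rewrite integral_dirac// diracE mem_set// mul1e.
split; last by rewrite muE.
apply/integrableP; split=> //.
by rewrite muE ?ltry//; exact: measurableT_comp.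
Qed.

Lemma measurable_translation y : measurable_fun setT ((fun x => x - y) : borel -> borel).
Proof.
refine (@measurability _ _ borel borel setT (fun x : 'rV[R]_n => x - y)
  (open : set (set 'rV[R]_n)) erefl _).
move=> _ [U oU <-]; rewrite setTI; apply: sub_sigma_algebra.
have cy : continuous (fun x : 'rV[R]_n => x - y).
  move=> x; apply: (@continuousB R 'rV[R]_n 'rV[R]_n id (fun=> y)).
    exact: cvg_id.
  exact: cst_continuous.
by move/continuousP: cy => /(_ U oU).
Qed.

(** The representing measure is pushed forward along x - y; its moments are integrals of the
    polynomials (x - y)^a against the original measure. *)
Lemma translate_moment_seq (K : set 'rV[R]_n) s y : is_moment_seq K s ->
  is_moment_seq [set k - y | k in K]
    (fun a => riesz s ('X_[a] \mPo translation (- y))).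
Proof.
move=> [mu [mu0 mus]].
pose phi : borel -> borel := fun x => x - y.
have mphi : measurable_fun setT phi by exact: measurable_translation.
pose nu := measure_function_pushforward__canonical__measure_function_Measure mu mphi.
exists nu; split.
  rewrite -[RHS]mu0 /nu /= /pushforward; congr (mu _).
  apply/seteqP; split=> x /= nx.
    by move=> Kx; apply: nx; exists x.
  by move=> [k Kk /addIr kx]; apply: nx; rewrite -kx.
move=> a; have [Ip sp] := integral_peval ('X_[a] \mPo translation (- y)) mus.
have E x : peval ('X_[a] \mPo translation (- y)) x = mono a (phi x).
  by rewrite peval_translation pevalX.
have ma : measurable_fun setT (fun x : borel => (mono a x)%:E).
  apply/measurable_EFinP; apply: (@continuous_borel_measurable R 'rV[R]_n (mono a)).
  exact: continuous_mono.
have Iphi : mu.-integrable setT ((fun x : borel => (mono a x)%:E) \o phi).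
  by apply: eq_integrable Ip => // x _ /=; rewrite E.
split; first exact: integrable_pushforward.
rewrite sp; have -> : (\int[nu]_x (mono a x)%:E = \int[mu]_x (mono a (phi x))%:E)%E.
  exact: (integral_pushforward mphi ma Iphi measurableT).
by apply: eq_integral => x _ /=; rewrite E.
Qed.

Lemma closed_translate (K : set 'rV[R]_n) y : closed K -> closed [set k - y | k in K].
Proof.
(* The image under a translation is the preimage under its inverse, so continuity gives
   closedness. *)
move=> cK; rewrite (_ : [set _ | _ in _] = (fun x => x + y) @^-1` K).
  have cy : continuous (fun x : 'rV[R]_n => x + y).
    move=> x; apply: (@continuousD R 'rV[R]_n 'rV[R]_n id (fun=> y)).
      exact: cvg_id.
    exact: cst_continuous.
  by move/continuous_closedP: cy => /(_ K cK).
apply/seteqP; split=> x /=.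
  by move=> [k Kk <-]; rewrite subrK.
by move=> Kxy; exists (x + y) => //; rewrite addrK.
Qed.

End Moments.

Theorem mainTheorem2 (R : realType) (n : nat) (K : set 'rV[R]_n)
  (hK : closed K)
  (q : mpoly.multinom n -> mpoly.mpoly n R)
  (T : mpoly.mpoly n R -> mpoly.mpoly n R)
  (hT : forall p, T p = diffop q p)
  (S : (mpoly.multinom n -> R) -> (mpoly.multinom n -> R))
  (hS : forall s p, riesz (S s) p = riesz s (T p)) :
  (forall s, is_moment_seq K s -> is_moment_seq K (S s)) <->
  (forall y, K y ->
     is_moment_seq [set k - y | k in K]
       (fun a => (mfact a)%:R * peval (q a) y)).
Proof.
split=> [SK y Ky|qK s sK].
  have := translate_moment_seq y (SK _ (dirac_moment_seq Ky)); congr is_moment_seq.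
  apply/funext => a.
  (* The translation by - y from the change of measure cancels the translation by [y] from Taylor's
     formula, leaving the Riesz functional of c_y at a monomial. *)
  by rewrite hS hT -peval_riesz peval_diffop translationK rieszX.
apply: haviland => // p p0; rewrite hS hT.
apply: (moment_seq_riesz_ge0 hK sK) => y Ky; rewrite peval_diffop.
apply: (moment_seq_riesz_ge0 (closed_translate hK) (qK y Ky)) => _ [k Kk <-].
by rewrite peval_translation subrK p0.
Qed.
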